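(* Let $G$ be a finite simple connected graph with $n(G)$ vertices and $m(G)$ edges. Then the maximum degree of its spanning tree auxiliary graph satisfies \[ \Delta(Aux(G))\le (n(G)-1)\,(m(G)-n(G)+1). \]
   Context: For a finite simple connected graph $G$ on $n$ vertices, the spanning tree auxiliary graph $Aux(G)$ is the graph whose vertices are the spanning trees of $G$, two spanning trees being adjacent if and only if one is obtained from the other by a single unit transformation, i.e. by adding one edge of $G$ not in the tree and deleting a different edge so that the result is again a spanning tree; equivalently, the symmetric difference of their edge sets has exactly two edges (they share exactly $n-2$ of their $n-1$ edges). *)

(* Defs.v *)
From HB Require Import structures.
From mathcomp Require Import all_boot all_order all_algebra.

Set Implicit Arguments.
Unset Strict Implicit.
Unset Printing Implicit Defensive.

Record sgraph (V : finType) := SGraph {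
  adj :> rel V;
  adj_sym : symmetric adj;
  adj_irrefl : irreflexive adj
}.

Section Graphs.
Variable V : finType.
Implicit Types (G : sgraph V) (F : {set {set V}}) (p : seq V).

Definition edges G : {set {set V}} :=
  [set [set x; y] | x in V, y in V & G x y].

Definition num_vertices G : nat := #|V|.

Definition num_edges G : nat := #|edges G|.

Definition degree G (x : V) : nat := #|[set y | G x y]|.

Definition max_degree G : nat := \max_(x : V) degree G x.

(* The graph without vertices does not count as connected. *)
Definition connected G : bool :=
  (0 < #|V|) && [forall x : V, forall y : V, connect G x y].

(* A cycle is a duplicate-free closed walk on at least three vertices: ucycleb
   alone also holds of [::] and of [:: x; y] for adjacent x and y.  Bounding
   the length by #|V| only serves to make the predicate boolean, see acyclicP. *)
Definition acyclic G : bool :=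
  ~~ [exists k : 'I_#|V|.+1, exists p : k.-tuple V, (2 < k) && ucycleb G p].

Lemma acyclicP G :
  reflect (forall p, ucycle G p -> size p <= 2) (acyclic G).
Proof.
apply: (iffP idP) => [/existsPn acG p cyc_p | acG].
  rewrite leqNgt; apply/negP => gt2.
  have szp : size p < #|V|.+1.
    by case/andP: cyc_p => _ /card_uniqP <-; rewrite ltnS max_card.
  have /existsPn/(_ (in_tuple p)) := acG (Ordinal szp).
  by rewrite /= gt2 /ucycleb; case/andP: cyc_p => -> ->.
apply/existsPn => k; apply/existsPn => p; apply/negP => /andP[gt2 cyc_p].
by have := acG p cyc_p; rewrite size_tuple leqNgt gt2.
Qed.

Definition is_tree G : bool := connected G && acyclic G.

Lemma edge_rel_sym F :
  symmetric [rel x y | (x != y) && ([set x; y] \in F)].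
Proof. by move=> x y /=; rewrite eq_sym setUC. Qed.

Lemma edge_rel_irrefl F :
  irreflexive [rel x y | (x != y) && ([set x; y] \in F)].
Proof. by move=> x /=; rewrite eqxx. Qed.

(* The graph on all of V whose edges are the two-element members of F. *)
Definition edge_graph F : sgraph V :=
  SGraph (@edge_rel_sym F) (@edge_rel_irrefl F).

(* A spanning tree is represented by its edge set. *)
Definition is_spanning_tree G F : bool :=
  (F \subset edges G) && is_tree (edge_graph F).

Definition spanning_tree G : finType :=
  {F : {set {set V}} | is_spanning_tree G F}.

(* F2 arises from F1 by adding an edge a of G outside F1 and then deleting an
   edge b different from a. *)
Definition unit_transformation G F1 F2 : bool :=
  [exists a in edges G :\: F1, exists b in a |: F1,
     (b != a) && (F2 == (a |: F1) :\ b)].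

Lemma unit_transformation_sym G (S1 S2 : spanning_tree G) :
  unit_transformation G (val S1) (val S2) =
  unit_transformation G (val S2) (val S1).
Proof.
suff imp (S S' : spanning_tree G) :
    unit_transformation G (val S) (val S') ->
    unit_transformation G (val S') (val S) by apply/idP/idP; apply: imp.
have /andP[/subsetP sSG _] := valP S.
case/exists_inP=> a /setDP[aG aNS] /exists_inP[b].
rewrite in_setU1 => /orP[/eqP-> /andP[]|bS /andP[ba /eqP->]]; first by rewrite eqxx.
apply/exists_inP; exists b; first by rewrite !inE eqxx sSG.
apply/exists_inP; exists a; first by rewrite !inE eqxx eq_sym ba orbT.
rewrite eq_sym ba /=; apply/eqP/setP => x; rewrite !inE.
have [->|xa] := eqVneq x a; first by rewrite (negbTE aNS).
by have [->|xb] := eqVneq x b; rewrite ?bS.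
Qed.

Lemma unit_transformation_irrefl G (S : spanning_tree G) :
  unit_transformation G (val S) (val S) = false.
Proof.
rewrite /unit_transformation; case: exists_inP => // -[a /setDP[_ aNS]].
case/exists_inP=> b _ /andP[ba /eqP eqS].
by case/negP: aNS; rewrite eqS !inE eqxx eq_sym ba.
Qed.

Definition Aux G : sgraph (spanning_tree G) :=
  @SGraph (spanning_tree G)
    (fun S1 S2 => unit_transformation G (val S1) (val S2))
    (@unit_transformation_sym G) (@unit_transformation_irrefl G).

End Graphs.

(* Main.v *)
Require Import Defs.
From mathcomp Require Import all_boot all_order all_algebra.
From mathcomp Require Import zify.
Import Order.TTheory GRing.Theory Num.Theory.
Local Open Scope ring_scope.

(** A neighbour of a spanning tree [F] in the auxiliary graph has the form
    [(a |: F) :\ b] with [a] an edge of [G] outside [F] and [b] in [F], so the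
    degree of [F] is at most [#|edges G :\: F| * #|F|].  The bound follows since
    a spanning tree of a graph with [n] vertices has exactly [n - 1] edges.

    Both halves of that count come from following the number of connected
    components while edges are inserted one at a time into the empty graph,
    which has [n] components.  An insertion merges at most two components
    ([leq_num_components_add]), so a connected graph has at least [n - 1] edges
    ([leq_card_edges_components]).  In an acyclic graph the ends of an edge lie
    in different components once that edge is removed
    ([acyclic_edge_disconnects]), so every insertion does merge two components
    ([ltn_num_components_add]), and there are at most [n - 1] edges
    ([acyclic_card_edges_components]).

    The lower bound, applied to [G] itself, also shows that the right-hand side
    is a natural number, so that the statement is one about [nat] and bounding
    each degree suffices. *)

(* The representative of a component, not a root of a polynomial. *)
Local Notation root := fingraph.root.

Section Components.
Variable V : finType.
Implicit Types (G : sgraph V) (F : {set {set V}}) (x y : V).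

Lemma sgraph_connect_sym G : connect_sym G.
Proof. by apply: sym_connect_sym; apply: adj_sym. Qed.

Definition num_components G : nat := #|[set root G x | x : V]|.

Lemma connected_num_components G : connected G -> num_components G = 1%N.
Proof.
case/andP=> /card_gt0P[r _] /forallP cG.
rewrite /num_components -(cards1 (root G r)); congr #|pred_of_set _|.
apply/setP=> z; rewrite inE; apply/imsetP/eqP=> [[x _ ->]|->]; last by exists r.
by apply/eqP; rewrite (root_connect (sgraph_connect_sym G)) (forallP (cG x)).
Qed.

(** The components of [G] are the finest partition that does not separate
    adjacent vertices: an invariant [h] factors through [root G]. *)
Lemma card_invariant_image G (h : V -> V) :
  (forall x y, G x y -> h x = h y) ->
  (#|[set h x | x : V]| <= num_components G)%N.
Proof.
move=> inv_h.
have inv_connect x y : connect G x y -> h x = h y.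
  case/connectP=> p; elim: p x => [|z p IHp] x /= => [_ -> //|].
  by case/andP=> /inv_h-> /IHp; apply.
rewrite /num_components.
have -> : [set h x | x : V] = [set h z | z in [set root G x | x : V]].
  rewrite -imset_comp; apply: eq_imset => x /=.
  exact/inv_connect/connect_root.
exact: leq_imset_card.
Qed.

Lemma leq_num_components_edge_graph0 :
  (#|V| <= num_components (edge_graph set0))%N.
Proof.
apply: leq_trans (card_invariant_image (edge_graph set0) id _).
  by rewrite (card_imset _ (@inj_id V)).
by move=> x y /=; rewrite inE andbF.
Qed.

(** The map [h] that sends the component of [x] to that of [y] is invariant
    in the larger graph, and misses at most one component of the smaller one. *)
Lemma leq_num_components_add F x y :
  (num_components (edge_graph F) <=
     (num_components (edge_graph ([set x; y] |: F))).+1)%N.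
Proof.
set G := edge_graph F; set G' := edge_graph _.
have symG := sgraph_connect_sym G.
pose h u := if root G u == root G x then root G y else root G u.
have inv_h u v : G' u v -> h u = h v.
  move=> /= /andP[uv]; rewrite in_setU1 => /orP[/eqP uvE|uvF].
    have : u \in [set x; y] by rewrite -uvE set21.
    have : v \in [set x; y] by rewrite -uvE set22.
    rewrite !inE /h => /orP[]/eqP-> /orP[]/eqP->; rewrite ?eqxx //.
      by case: ifP.
    by case: ifP.
  have /(fingraph.rootP symG) : connect G u v by apply: connect1; rewrite /= uv.
  by rewrite /h => ->.
apply: leq_trans (_ : #|root G x |: [set h u | u : V]| <= _)%N.
  apply/subset_leq_card/subsetP=> _ /imsetP[u _ ->]; rewrite in_setU1.
  have [//|ux] := eqVneq; apply/imsetP; exists u => //.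
  by rewrite /h (negbTE ux).
rewrite cardsU1 -add1n; apply: leq_add; first by case: (_ \notin _).
exact: card_invariant_image.
Qed.

(** Representatives in the larger graph factor through those in the smaller one,
    and this factor identifies the representatives of [x] and [y]. *)
Lemma ltn_num_components_add F x y :
  x != y -> ~~ connect (edge_graph F) x y ->
  (num_components (edge_graph ([set x; y] |: F)) <
     num_components (edge_graph F))%N.
Proof.
set G := edge_graph F; set G' := edge_graph _ => xy NGxy.
have symG := sgraph_connect_sym G; have symG' := sgraph_connect_sym G'.
have subGG' u v : connect G u v -> connect G' u v.
  apply: connect_sub => {}u {}v /= /andP[uv uvF]; apply: connect1 => /=.
  by rewrite uv in_setU1 uvF orbT.
have root'_root u : root G' (root G u) = root G' u.
  by apply/esym/(fingraph.rootP symG'); apply: subGG'; apply: connect_root.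
have root'_xy : root G' x = root G' y.
  by apply/(fingraph.rootP symG'); apply: connect1; rewrite /= xy in_setU1 eqxx.
have root_xy : root G y != root G x.
  by rewrite eq_sym (root_connect symG).
rewrite /num_components [X in (_ < X)%N](cardsD1 (root G x)) imset_f //.
rewrite add1n ltnS.
apply: leq_trans (leq_imset_card (root G') _).
apply/subset_leq_card/subsetP=> _ /imsetP[u _ ->].
have [ux|ux] := eqVneq (root G u) (root G x).
  apply/imsetP; exists (root G y); first by rewrite !inE root_xy imset_f.
  by rewrite -root'_root ux !root'_root.
by apply/imsetP; exists (root G u); rewrite ?root'_root // !inE ux imset_f.
Qed.

(** Otherwise a path joining the two ends, closed up by the removed edge, would
    be a cycle. *)
Lemma acyclic_edge_disconnects F x y :
  x != y -> [set x; y] \in F -> acyclic (edge_graph F) ->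
  ~~ connect (edge_graph (F :\ [set x; y])) x y.
Proof.
move=> xy xyF /acyclicP acF; apply/negP=> /connectP[p0 p0P yE].
move: yE; case/shortenP: p0P => p pP uniq_p _ yE.
have subF : subrel (edge_graph (F :\ [set x; y])) (edge_graph F).
  by move=> u v /= /andP[-> /setD1P[_ ->]].
have cyc : ucycle (edge_graph F) (x :: p).
  apply/andP; split=> //; rewrite /= rcons_path (sub_path subF pP) -yE.
  by rewrite /= eq_sym xy setUC xyF.
(* A closed walk of length two would use the removed edge itself. *)
have := acF _ cyc; case: p pP yE {uniq_p cyc} => [_ xE|z [|//]] /=.
  by rewrite xE eqxx in xy.
by rewrite !inE => + zE; rewrite -zE eqxx andbF.
Qed.

Lemma acyclic_sub F F' :
  F' \subset F -> acyclic (edge_graph F) -> acyclic (edge_graph F').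
Proof.
move=> /subsetP sF /acyclicP acF; apply/acyclicP=> p /andP[cyc_p uniq_p].
apply: acF; apply/andP; split=> //; apply: sub_cycle cyc_p => u v /= /andP[-> /sF].
by [].
Qed.

Lemma in_edges G (e : {set V}) :
  e \in edges G -> exists x y, x != y /\ e = [set x; y].
Proof.
case/imset2P=> x y _; rewrite inE => /andP[_ Gxy] ->; exists x, y; split=> //.
by apply: contraTneq Gxy => ->; rewrite adj_irrefl.
Qed.

(** The edges of [G] are pairs of distinct vertices, so an edge set can be built
    up from the empty one by inserting such pairs. *)
Lemma edge_set_ind G (P : {set {set V}} -> Prop) :
  P set0 ->
  (forall F x y, x != y -> [set x; y] \notin F -> P F -> P ([set x; y] |: F)) ->
  forall F, F \subset edges G -> P F.
Proof.
move=> P0 PS F; move: {2}#|F| (erefl #|F|) => k.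
elim: k F => [|k IHk] F => [/eqP|Fk sF]; first by rewrite cards_eq0 => /eqP->.
have /card_gt0P[e eF] : (0 < #|F|)%N by rewrite Fk.
have [x [y [xy eE]]] := in_edges G e (subsetP sF e eF).
rewrite -(setD1K eF) eE; apply: PS; rewrite -?eE ?setD11 //.
apply: IHk; last by apply: subset_trans (subsetDl _ _) sF.
by move: Fk; rewrite (cardsD1 e) eF => -[].
Qed.

Lemma leq_card_edges_components G F : F \subset edges G ->
  (#|V| <= #|F| + num_components (edge_graph F))%N.
Proof.
move: F; apply: edge_set_ind => [|F x y _ xyF IHF].
  by rewrite cards0 leq_num_components_edge_graph0.
rewrite cardsU1 xyF; have := leq_num_components_add F x y; lia.
Qed.

Lemma acyclic_card_edges_components G F :
  F \subset edges G -> acyclic (edge_graph F) ->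
  (#|F| + num_components (edge_graph F) <= #|V|)%N.
Proof.
move: F; apply: edge_set_ind => [_|F x y xy xyF IHF acF].
  by rewrite cards0 add0n; apply: leq_imset_card.
have IH := IHF (acyclic_sub _ _ (subsetUr _ _) acF).
have := acyclic_edge_disconnects _ _ _ xy (setU11 _ _) acF.
rewrite setU1K // => /(ltn_num_components_add F x y xy).
by rewrite cardsU1 xyF; lia.
Qed.

Lemma card_spanning_tree G F : is_spanning_tree G F -> (#|F|.+1 = #|V|)%N.
Proof.
case/andP=> sFG /andP[cF acF]; apply/eqP; rewrite -addn1 eqn_leq.
rewrite -(connected_num_components _ cF).
by rewrite (acyclic_card_edges_components G) ?(leq_card_edges_components G).
Qed.

Lemma edge_graph_edges G : edge_graph (edges G) =2 G.
Proof.
move=> x y /=; apply/andP/idP=> [[xy /imset2P[u v _]]|Gxy].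
  rewrite inE => /andP[_ Guv] xyE.
  have : x \in [set u; v] by rewrite -xyE set21.
  have : y \in [set u; v] by rewrite -xyE set22.
  rewrite !inE => /orP[]/eqP yE /orP[]/eqP xE; move: xy; rewrite xE yE ?eqxx //.
  by rewrite adj_sym.
split; first by apply: contraTneq Gxy => ->; rewrite adj_irrefl.
by apply/imset2P; exists x y; rewrite ?inE.
Qed.

Lemma connected_card_edges G :
  connected G -> (#|V| <= (num_edges G).+1)%N.
Proof.
move=> cG; have := leq_card_edges_components G _ (subxx _).
suff /connected_num_components-> : connected (edge_graph (edges G)).
  by rewrite addn1.
case/andP: cG => V0 /forallP cG; rewrite /connected V0.
apply/forallP=> x; apply/forallP=> y.
by rewrite (eq_connect (edge_graph_edges G)) (forallP (cG x)).
Qed.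

(** Every neighbour of [S] comes from some pair [(a, b)]; as [b] differs from
    [a], the deleted edge is one of [S] itself. *)
Lemma degree_Aux_le G (S : spanning_tree G) :
  (degree (Aux G) S <= #|edges G :\: val S| * #|val S|)%N.
Proof.
rewrite /degree -cardsX -(card_imset _ val_inj).
pose exchange (ab : {set V} * {set V}) := (ab.1 |: val S) :\ ab.2.
apply: leq_trans (leq_imset_card exchange _).
apply/subset_leq_card/subsetP=> _ /imsetP[S' + ->].
rewrite inE => /exists_inP[a aP /exists_inP[b bP /andP[ba /eqP S'E]]].
apply/imsetP; exists (a, b) => //; rewrite in_setX aP /=.
by move: bP; rewrite in_setU1 (negbTE ba).
Qed.

End Components.

Theorem lemma10 (V : finType) (G : sgraph V) (hG : connected G) :
  (max_degree (Aux G))%:Z <=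
    ((num_vertices G)%:Z - 1) *
    ((num_edges G)%:Z - (num_vertices G)%:Z + 1).
Proof.
have n_le := connected_card_edges _ G hG; have /andP[n_gt0 _] := hG.
have -> : ((num_vertices G)%:Z - 1) *
          ((num_edges G)%:Z - (num_vertices G)%:Z + 1) =
          (#|V|.-1 * ((num_edges G).+1 - #|V|))%N%:Z.
  by rewrite PoszM /num_vertices; congr (_ * _); lia.
rewrite lez_nat; apply/bigmax_leqP=> S _.
apply: leq_trans (degree_Aux_le _ _ S) _.
have /andP[sSG _] := valP S; have SE := card_spanning_tree _ _ _ (valP S).
by rewrite cardsD (setIidPr sSG) -SE subSS mulnC.
Qed.
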